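(* Let $(c_n)_{n\in\mathbb{N}}\subset[0,\infty)$ and let $(I_n)_{n\in\mathbb{N}}$, $I_n\subset\mathbb{R}$, be sequences such that \[ \lim_{n \rightarrow \infty} \mathbb{P}\left(\sup_{y \in \mathbb{R}, \, x \in I_n} |\tilde{M}_{n;x}(y) - M_{x}(y)| \geq c_n \right) = 0, \qquad (\mathrm{A}) \] and let $I\subseteq\mathbb{R}$ be a set such that $I_n\subseteq I$ for all $n\in\mathbb{N}$. (i) If there exist $J \subseteq \mathbb{R}$ and constants $C\geq 0$, $\beta > 0$ such that $|F_x(y) - F_x(z)| \leq C|y - z|^{\beta}$ for all $y, z \in J$, $x \in I$, then with $J_n = \{y \in J: \, y \pm c_n^{1/(1 + \beta)} \in J\}$, \[ \lim_{n \rightarrow \infty} \mathbb{P}\left(\sup_{y \in J_n, \, x \in I_n} |\hat{F}_{n;x}(y) - F_{x}(y)| \geq (2 + C)c_n^{\beta/(1+\beta)} \right) = 0. \] (ii) If the distribution functions $F_x$, $x \in I$, have support in $\mathbb{Z}$, the responses are integer-valued, and $\tilde{M}_{n; x}$ is computed with grid $\{y_1, y_1 + 1, \dots, y_{m} - 1, y_m\}$ (see the context), then \[ \lim_{n \rightarrow \infty} \mathbb{P}\left(\sup_{y \in \mathbb{R}, \, x \in I_n} |\hat{F}_{n;x}(y) - F_{x}(y)| \geq 2c_n \right) = 0. \]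
   Context: Notation: $(z)_+ = \max(z,0)$; ''increasing'' and ''decreasing'' are meant in the weak sense; $y\pm\delta\in J$ means both $y-\delta\in J$ and $y+\delta\in J$. Model. $(F_x)_x$ is a family of cumulative distribution functions (CDFs) on $\mathbb{R}$ with finite first moments, indexed by a subset of $\mathbb{R}$ that contains $I$ and all values of the covariates, and $M_x(y) = \int_{-\infty}^y F_x(t)\,dt$, i.e. $M_x(y)=\mathbb{E}[(y-Y)_+]$ for $Y\sim F_x$. The family is increasing in $x$ in the increasing concave order: $M_x(y)\ge M_{x'}(y)$ for all $y\in\mathbb{R}$ whenever $x\le x'$. Let $(X_{ni},Y_{ni})$, $i=1,\dots,n$, $n\in\mathbb{N}$, be a triangular array of real random pairs on a probability space with probability measure $\mathbb{P}$. For each $n$, the covariates $X_{n1},\dots,X_{nn}$ are independent; conditionally on $X_{n1},\dots,X_{nn}$, the responses $Y_{n1},\dots,Y_{nn}$ are independent, and the conditional CDF of $Y_{ni}$ is $F_{X_{ni}}$. Estimators. Fix $n$. Let $x_1<\dots<x_d$ and $y_1<\dots<y_m$ be the distinct values of $X_{n1},\dots,X_{nn}$ and of $Y_{n1},\dots,Y_{nn}$, respectively; let $w_i=\#\{j\le n: X_{nj}=x_i\}$ and $h_i(y)=\frac{1}{w_i}\sum_{j: X_{nj}=x_i}(y-Y_{nj})_+$. For each $y\in\mathbb{R}$, $(\tilde M_{n;x_1}(y),\dots,\tilde M_{n;x_d}(y))$ is the unique minimizer of $\sum_{i=1}^d w_i[\eta_i-h_i(y)]^2$ over all $\eta\in\mathbb{R}^d$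 with $\eta_1\ge\dots\ge\eta_d$. For $x\notin\{x_1,\dots,x_d\}$, $\tilde M_{n;x}(y)$ is any choice satisfying $\tilde M_{n;x_i}(y)\ge\tilde M_{n;x}(y)\ge\tilde M_{n;x_{i+1}}(y)$ for all $y\in\mathbb{R}$ if $x\in[x_i,x_{i+1})$, $\tilde M_{n;x}(y)=\tilde M_{n;x_1}(y)$ if $x<x_1$, and $\tilde M_{n;x}(y)=\tilde M_{n;x_d}(y)$ if $x\ge x_d$. For each $x$, $\hat M_{n;x}$ is the greatest convex minorant of the function $y\mapsto\tilde M_{n;x}(y)$ on $\mathbb{R}$, i.e. the pointwise greatest convex function bounded from above by $\tilde M_{n;x}$, and $\hat F_{n;x}(y)$ is the right-hand derivative of $\hat M_{n;x}$ at $y$. Computation with a grid $t_1<\dots<t_k$, $t_1=y_1$, $t_k=y_m$: $\tilde M_{n;x}$ is evaluated only at $y\in\{t_1,\dots,t_k\}$, where, for each such $y$, $(\tilde M_{n;x_1}(y),\dots,\tilde M_{n;x_d}(y))$ is the unique minimizer of $\sum_{i=1}^d w_i[\eta_i-h_i(y)]^2$ over all $\eta\in\mathbb{R}^d$ with $\eta_1\ge\dots\ge\eta_d$, and, for $x\notin\{x_1,\dots,x_d\}$, $\tilde M_{n;x}(y)$ is any choice satisfying $\tilde M_{n;x_i}(y)\ge\tilde M_{n;x}(y)\ge\tilde M_{n;x_{i+1}}(y)$ if $x\in[x_i,x_{i+1})$, $\tilde M_{n;x}(y)=\tilde M_{n;x_1}(y)$ if $x<x_1$, and $\tilde M_{n;x}(y)=\tilde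 M_{n;x_d}(y)$ if $x\ge x_d$; for every $x$, $\tilde M_{n;x}$ is then interpolated linearly in $y$ between consecutive grid points, is set to $0$ for $y\le t_1$, and is set to $\tilde M_{n;x}(t_k)+(y-t_k)$ for $y\ge t_k$. In part (ii), $\tilde M_{n;x}$ (also in condition (A)) denotes the function computed in this way with the stated grid, and $\hat M_{n;x}$ and $\hat F_{n;x}$ are its greatest convex minorant and the right-hand derivative thereof. *)

(* Defs.v *)
From mathcomp Require Export all_boot all_order all_algebra.
From mathcomp Require Export all_classical all_reals all_analysis.
Export Order.TTheory GRing.Theory Num.Theory.
Export numFieldNormedType.Exports.

Set Implicit Arguments.
Unset Strict Implicit.
Unset Printing Implicit Defensive.

Local Open Scope classical_set_scope.
Local Open Scope ring_scope.

Section model.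
Context (R : realType).

(* A CDF on R is an element of [cumulativeBounded 0 1]; its law is the
   associated Lebesgue-Stieltjes measure. *)
Definition finite_first_moment (F : cumulativeBounded (0 : R) (1 : R)) : Prop :=
  (lebesgue_stieltjes_measure F).-integrable setT (EFin : R -> \bar R).

Definition supported_in_Z (F : cumulativeBounded (0 : R) (1 : R)) : Prop :=
  lebesgue_stieltjes_measure F (~` range (intr : int -> R)) = 0%E.

Definition integrated_cdf (F : R -> R) (y : R) : R :=
  \int[lebesgue_measure]_(t in `]-oo, y]) F t.

Context (d : measure_display) (T : measurableType d) (P : probability T R).

(* Taking [B i = setT] for some indices gives the product rule over every
   subfamily. *)
Definition mutually_independent (n : nat) (X : 'I_n -> {RV P >-> R}) : Prop :=
  forall B : 'I_n -> set R, (forall i, measurable (B i)) ->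
    P (\bigcap_i (X i @^-1` B i)) = (\prod_(i < n) P (X i @^-1` B i))%E.

Definition cond_prob_version (G : set (set T)) (A : set T) (f : T -> R) : Prop :=
  [/\ forall B : set R, measurable B -> G (f @^-1` B),
      P.-integrable setT (EFin \o f) &
      forall B : set T, G B -> P (A `&` B) = (\int[P]_(w in B) (f w)%:E)%E].

Definition cond_independent (G : set (set T)) (n : nat)
    (Y : 'I_n -> {RV P >-> R}) : Prop :=
  forall B : 'I_n -> set R, (forall i, measurable (B i)) ->
    exists f : 'I_n -> T -> R,
      (forall i, cond_prob_version G (Y i @^-1` B i) (f i)) /\
      cond_prob_version G (\bigcap_i (Y i @^-1` B i))
        (fun w => \prod_(i < n) f i w).

Definition cond_cdf (G : set (set T)) (Y : {RV P >-> R}) (K : T -> R -> R) : Prop :=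
  forall y : R, cond_prob_version G (Y @^-1` `]-oo, y]) (fun w => K w y).

(* Suprema over uncountable index sets need not be measurable, and neither need
   the estimator be in [x] between the design points, where it is an arbitrary
   choice. Probabilities of such events are therefore outer probabilities; they
   coincide with [P] on measurable events ([measurable_mu_extE]). *)
Definition outer_prob (A : set T) : \bar R := (P^*)%mu A.

End model.

Section estimators.
Context (R : realType) (n : nat) (X Y : 'I_n -> R).

Definition distinct_values (Z : 'I_n -> R) : seq R :=
  sort <=%R (undup (codom Z)).

Let xs := distinct_values X.

Definition weight (x : R) : nat := #|[set j : 'I_n | X j == x]|.

Definition local_mean (x y : R) : R :=
  (weight x)%:R^-1 * \sum_(j < n | X j == x) Num.max (y - Y j) 0.

Definition iso_objective (y : R) (eta : 'I_(size xs) -> R) : R :=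
  \sum_(i < size xs)
    (weight xs`_i)%:R * (eta i - local_mean xs`_i y) ^+ 2.

Definition antitone_vector (k : nat) (eta : 'I_k -> R) : Prop :=
  forall i j : 'I_k, (i <= j)%N -> eta j <= eta i.

Definition iso_minimizer (y : R) (eta : 'I_(size xs) -> R) : Prop :=
  antitone_vector eta /\
  forall eta' : 'I_(size xs) -> R, antitone_vector eta' ->
    iso_objective y eta <= iso_objective y eta'.

(* [g] is the estimator as a function of the covariate, for fixed [y]. *)
Definition admissible_in_x (g : R -> R) : Prop :=
  forall x : R, x \notin xs ->
    [/\ forall i : nat, (i.+1 < size xs)%N -> xs`_i <= x < xs`_i.+1 ->
          g xs`_i.+1 <= g x <= g xs`_i,
        x < xs`_0 -> g x = g xs`_0 &
        xs`_(size xs).-1 <= x -> g x = g xs`_(size xs).-1].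

Definition fitted_at (m : R -> R -> R) (y : R) : Prop :=
  iso_minimizer y (fun i => m xs`_i y) /\ admissible_in_x (fun x => m x y).

(* [m x y] stands for M~_{n;x}(y). *)
Definition is_Mtilde (m : R -> R -> R) : Prop := forall y : R, fitted_at m y.

Definition grid_extension (t : seq R) (f : R -> R) : Prop :=
  [/\ forall (j : nat) (y : R), (j.+1 < size t)%N -> t`_j <= y <= t`_j.+1 ->
        f y = f t`_j + (y - t`_j) / (t`_j.+1 - t`_j) * (f t`_j.+1 - f t`_j),
      forall y : R, y <= t`_0 -> f y = 0 &
      forall y : R, t`_(size t).-1 <= y ->
        f y = f t`_(size t).-1 + (y - t`_(size t).-1)].

Definition is_Mtilde_grid (t : seq R) (m : R -> R -> R) : Prop :=
  (forall y : R, y \in t -> fitted_at m y) /\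
  (forall x : R, grid_extension t (m x)).

(* y_1, y_1 + 1, ..., y_m - 1, y_m, for integer-valued responses *)
Definition unit_grid : seq R :=
  let ys := distinct_values Y in
  [seq ys`_0 + k%:R |
    k <- iota 0 (Num.truncn (ys`_(size ys).-1 - ys`_0)).+1].

End estimators.

Section convex_minorant.
Context (R : realType).

Definition convex_on_line (g : R -> R) : Prop :=
  @convex_function R R^o setT g.

Definition is_gcm (f g : R -> R) : Prop :=
  [/\ convex_on_line g, forall y, g y <= f y &
      forall h : R -> R, convex_on_line h -> (forall y, h y <= f y) ->
        forall y, h y <= g y].

(* junk value 0 if there is no convex minorant *)
Definition gcm (f : R -> R) : R -> R := xget (fun=> 0) [set g | is_gcm f g].

Definition right_derivative (f : R -> R) (y : R) : R :=
  lim ((h^-1 * (f (y + h) - f y)) @[h --> 0^'+]).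

Definition Fhat (m : R -> R -> R) (x y : R) : R :=
  right_derivative (gcm (m x)) y.

Definition sup_dist (A B : set R) (f g : R -> R -> R) : \bar R :=
  ereal_sup [set (`|f x y - g x y|)%:E | y in A & x in B].

End convex_minorant.

(* Main.v *)
(* The argument is deterministic. Write M for the integrated CDF of F, which is
   convex. If |M~ - M| <= s everywhere, then M - s is a convex minorant of M~,
   so the greatest convex minorant M^ of M~ also satisfies |M^ - M| <= s.
   By convexity, the right derivative of M^ at y lies between the slopes of M^
   over [y - e, y] and [y, y + e], hence between F(y - e) - 2s/e and
   F(y + e) + 2s/e; part (i) is the choice e = c_n^(1/(1+beta)) with s < c_n.
   In part (ii), M^ is affine between consecutive integers, where F is constant,
   so that F^ - F is a difference of increments of M^ and M over a unit interval,
   bounded by 2s. *)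
From HB Require Import structures.
Require Import Defs.
From mathcomp Require Import ring lra zify measurable_realfun.

Set Implicit Arguments.
Unset Strict Implicit.
Unset Printing Implicit Defensive.

Local Open Scope classical_set_scope.
Local Open Scope ring_scope.

(** * Integrability of a CDF on left half-lines, and increments of its integral *)

Section integrated_cdf.
Context (R : realType) (F : cumulativeBounded (0 : R) (1 : R)).

(** The identity as a random variable under the Lebesgue-Stieltjes measure of [F]; its CDF is
    [F]. *)
Let idTR : measurableTypeR R -> R := idfun.

#[local] HB.instance Definition _ :=
  @isMeasurableFun.Build _ _ _ _ idTR (@measurable_id _ _ setT).

Lemma cumulativeBounded_ge0 (y : R) : 0 <= F y.
Proof. by rewrite -lee_fin -cdf_lebesgue_stieltjes_id. Qed.

(* Without this, [integrated_cdf F] could be the junk value 0 of a divergent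
   integral; it is where the finite first moment is needed. *)
Lemma integrable_cdf (y : R) : finite_first_moment F ->
  lebesgue_measure.-integrable `]-oo, y] (EFin \o F).
Proof.
move=> iF.
have Fge0 x : (0 <= (F x)%:E)%E by rewrite lee_fin cumulativeBounded_ge0.
have mF (D : set R) : measurable D -> measurable_fun D F.
  by move=> mD; apply: nondecreasing_measurable => //;
    exact: cumulative_is_nondecreasing.
have L1 : Lfun (lebesgue_stieltjes_measure F) 1 idTR by exact/Lfun1_integrable.
have := expectation_fin_num L1.
(* The expectation is the upper-tail integral over the positive half-line minus the integral of [F]
   over the negative one; a finite difference forces both to be finite. *)
rewrite (expectation_cdf_ccdf (X := (idTR : {RV _ >-> R})) L1) fin_numB => /andP[_].
under eq_integral do rewrite cdf_lebesgue_stieltjes_id.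
move=> fB.
suff : lebesgue_measure.-integrable (`]-oo, 0[ `|` `[0, Num.max 0 y]) (EFin \o F).
  apply: integrableS => //; first exact: measurableU.
  move=> x /=; rewrite !in_itv/= => xy.
  by have [x0|x0] := ltP x 0; [left|right; rewrite le_max xy orbT].
have mU : measurable_fun (`]-oo, 0[ `|` `[0, Num.max 0 y]) (EFin \o F).
  by apply/measurable_EFinP; apply: mF; exact: measurableU.
apply/integrableP; split => //.
under eq_integral do rewrite /= ger0_norm ?cumulativeBounded_ge0//.
rewrite ge0_integral_setU//=; last first.
  apply/disj_setPS => x [/=]; rewrite !in_itv/= => x0 /andP[].
  by rewrite leNgt x0.
rewrite lte_add_pinfty//; first by rewrite -ge0_fin_numE// integral_ge0.
have /integrableP[_] : lebesgue_measure.-integrable `[0, Num.max 0 y] (EFin \o F).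
  apply: measurable_bounded_integrable => //; last 2 first.
  - exact: mF.
  - exists (F (Num.max 0 y)); split; first exact: num_real.
    move=> M yM x /=; rewrite in_itv/= => /andP[_ xy].
    rewrite ger0_norm ?cumulativeBounded_ge0// (le_trans _ (ltW yM))//.
    exact: cumulative_is_nondecreasing.
  by rewrite /= lebesgue_measure_itv/=; case: ifPn => _; rewrite -?EFinB ltry.
by under eq_integral do rewrite /= ger0_norm ?cumulativeBounded_ge0//.
Qed.

(** The bounds concern the open interval only, because in the integer case [F] may jump at the right
    end point; end points are null sets. *)
Lemma integrated_cdfB (a b y z : R) : finite_first_moment F -> y <= z ->
  (forall t, y < t < z -> a <= F t <= b) ->
  a * (z - y) <= integrated_cdf F z - integrated_cdf F y <= b * (z - y).
Proof.
move=> iF yz ab; rewrite /integrated_cdf Rintegral_itvB//; last exact: integrable_cdf.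
have iyz : lebesgue_measure.-integrable `]y, z[ (EFin \o F).
  apply: integrableS (integrable_cdf z iF) => // t /=; rewrite !in_itv/=.
  by move=> /andP[_ /ltW].
rewrite -Rintegral_itv_bndo_bndc//.
have cstE (r : R) : r * (z - y) = \int[lebesgue_measure]_(t in `]y, z[) (cst r t).
  rewrite Rintegral_cst//= lebesgue_measure_itv/= lte_fin.
  have [yz0|zy|->] := ltgtP y z; [by rewrite -EFinB|by rewrite ltNge yz in zy|].
  by rewrite subrr.
have icst (r : R) : lebesgue_measure.-integrable `]y, z[ (EFin \o cst r).
  apply: measurable_bounded_integrable => //.
    by rewrite /= lebesgue_measure_itv/=; case: ifPn => _; rewrite -?EFinB ltry.
  exact: bounded_cst.
by rewrite !cstE; apply/andP; split; apply: le_Rintegral => //= t;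
  rewrite in_itv/= => /ab/andP[].
Qed.

End integrated_cdf.

(** * Convex functions, greatest convex minorants and right derivatives *)

Section convex_on_line.
Context {R : realType}.
Implicit Types (f g h : R -> R).

Lemma convex_on_lineP g : convex_on_line g <->
  forall t x y, 0 <= t <= 1 ->
    g (t * x + (1 - t) * y) <= t * g x + (1 - t) * g y.
Proof.
split=> [cg t x y /andP[t0 t1]|cg t x y _ _]; last first.
  by apply: cg; rewrite ge0 le1.
by have := cg (Itv01 t0 t1) x y (mem_set I) (mem_set I).
Qed.

(** Slope comparison with denominators cleared, so that [a = c] is no exception and later uses
    reduce to linear arithmetic. *)
Lemma convex_on_line_chord g a b c : convex_on_line g -> a <= b <= c ->
  (c - a) * g b <= (c - b) * g a + (b - a) * g c.
Proof.
move=> /convex_on_lineP cg /andP[ab bc].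
have [ca|ac] := leP c a.
  have -> : b = a by apply/le_anti; rewrite ab (le_trans bc).
  have -> : c = a by apply/le_anti; rewrite ca (le_trans ab).
  lra.
have ca0 : 0 < c - a by rewrite subr_gt0.
have t01 : 0 <= (c - b) / (c - a) <= 1.
  by rewrite divr_ge0 ?subr_ge0 ?(ltW ac)//= ler_pdivrMr// mul1r lerD2l lerN2.
have := cg _ a c t01.
have -> : (c - b) / (c - a) * a + (1 - (c - b) / (c - a)) * c = b.
  by field; rewrite gt_eqF.
rewrite -(ler_pM2l ca0) => /le_trans; apply.
by rewrite le_eqVlt; apply/orP; left; apply/eqP; field; rewrite gt_eqF.
Qed.

Lemma convex_on_line_support g :
  (forall y, exists a, forall z, g y + a * (z - y) <= g z) -> convex_on_line g.
Proof.
move=> sg; apply/convex_on_lineP => t x y /andP[t0 t1].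
set u := t * x + _; have [a ga] := sg u.
have t1' : 0 <= 1 - t by lra.
have -> : g u = t * (g u + a * (x - u)) + (1 - t) * (g u + a * (y - u)).
  by rewrite /u; ring.
by rewrite lerD// ler_wpM2l.
Qed.

Lemma convex_on_line_max g h : convex_on_line g -> convex_on_line h ->
  convex_on_line (g \max h).
Proof.
move=> /convex_on_lineP cg /convex_on_lineP ch.
apply/convex_on_lineP => t x y t01 /=; have /andP[t0 t1] := t01.
have t1' : 0 <= 1 - t by lra.
by rewrite ge_max (le_trans (cg _ _ _ t01)) ?(le_trans (ch _ _ _ t01))// lerD//
  ler_wpM2l// le_max lexx// orbT.
Qed.

Lemma convex_on_line_affine (a b c : R) : convex_on_line (fun y => a + b * (y - c)).
Proof.
apply/convex_on_lineP => t x y _.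
by rewrite le_eqVlt; apply/orP; left; apply/eqP; ring.
Qed.

(** A single convex minorant rules out the junk value of [gcm]: the pointwise supremum of all of
    them is then finite, convex and greatest. *)
Lemma gcmP f h : convex_on_line h -> (forall y, h y <= f y) ->
  is_gcm f (gcm f).
Proof.
move=> ch hf; rewrite /gcm; case: xgetP => [g -> //|] nog; exfalso.
pose minorants := [set g | convex_on_line g /\ forall y, g y <= f y].
pose g y := sup [set k y | k in minorants].
have supS y : has_sup [set k y | k in minorants].
  by split; [exists (h y), h|exists (f y) => _ [k [_ kf] <-]].
have le_g k y : minorants k -> k y <= g y.
  by move=> mk; apply: sup_upper_bound => //; exists k.
apply: (nog g); split => //.
- apply/convex_on_lineP => t x y t01; have /andP[t0 t1] := t01.
  have t1' : 0 <= 1 - t by lra.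
  apply: ge_sup; first by case: (supS (t * x + (1 - t) * y)).
  move=> _ [k mk <-]; have /convex_on_lineP ck := mk.1.
  by rewrite (le_trans (ck _ _ _ t01))// lerD// ler_wpM2l// le_g.
- move=> y; apply: ge_sup; first by case: (supS y).
  by move=> _ [k [_ kf] <-].
- by move=> k ck kf y; exact: le_g.
Qed.

(* The maximum of [gcm f] and its chord line over [p, q] is again a convex
   minorant of [f], hence equal to [gcm f]. *)
Lemma gcm_affine f p q : is_gcm f (gcm f) -> p < q ->
  (forall y, p <= y <= q ->
     f y = f p + (f q - f p) / (q - p) * (y - p)) ->
  let l y := gcm f p + (gcm f q - gcm f p) / (q - p) * (y - p) in
  (forall y, l y <= gcm f y) /\ (forall y, p <= y <= q -> gcm f y = l y).
Proof.
move=> [cg gf maxg] pq fa l; set g := gcm f in cg gf maxg l *.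
have qp0 : 0 < q - p by rewrite subr_gt0.
have lE y : (q - p) * l y = (q - y) * g p + (y - p) * g q.
  by rewrite /l; field; rewrite gt_eqF.
(* On [[p, q]] both [l] and [f] are affine and [g <= f] at the end points; outside, the extended
   chord [l] lies below the convex [g]. *)
have lf y : p <= y <= q -> l y <= f y.
  move=> pyq; rewrite fa// -(ler_pM2l qp0) lE.
  have -> : (q - p) * (f p + (f q - f p) / (q - p) * (y - p)) =
     (q - y) * f p + (y - p) * f q by field; rewrite gt_eqF.
  by case/andP: pyq => py yq; rewrite lerD// ler_wpM2l// subr_ge0.
have lg y : y <= p \/ q <= y -> l y <= g y.
  move=> pyq; rewrite -(ler_pM2l qp0) lE.
  by case: pyq => [yp|qy]; [have := @convex_on_line_chord g y p q cg
   |have := @convex_on_line_chord g p q y cg]; rewrite ?yp ?qy ?(ltW pq) => /(_ isT); lra.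
have l_le y : l y <= g y.
  have cgl := @convex_on_line_max g l cg (convex_on_line_affine _ _ _).
  have glf z : (g \max l) z <= f z.
    rewrite /= ge_max gf/=.
    have [zp|pz] := leP z p; first by rewrite (le_trans _ (gf z))// lg//; left.
    have [qz|zq] := leP q z; first by rewrite (le_trans _ (gf z))// lg//; right.
    by rewrite lf// !ltW.
  by apply: le_trans (maxg _ cgl glf y); rewrite /= le_max lexx orbT.
split=> // y pyq; apply/le_anti; rewrite l_le andbT -(ler_pM2l qp0) lE.
exact: convex_on_line_chord.
Qed.

(** Difference quotients of a convex function are nondecreasing in the step and here bounded below
    by [a], so the limit at 0 exists; it lies below the quotient for step [e]. *)
Lemma right_derivative_bounds g y (a b e : R) : convex_on_line g -> 0 < e ->
  (forall z, y < z -> a * (z - y) <= g z - g y) ->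
  g (y + e) - g y <= b * e ->
  a <= right_derivative g y <= b.
Proof.
move=> cg e0 ga gb; set q := fun h : R => h^-1 * (g (y + h) - g y).
have aq (h : R) : 0 < h -> a <= q h.
  move=> h0; have := ga (y + h); rewrite ltrDl h0 addrAC subrr add0r => /(_ isT).
  by move=> ?; rewrite /q ler_pdivlMl// mulrC.
have qnd : {in `]0, +oo[ &, nondecreasing_fun q}.
  move=> s t; rewrite !in_itv/= !andbT => s0 t0 st.
  have := @convex_on_line_chord g y (y + s) (y + t) cg.
  rewrite lerDl lerD2l ltW//= => /(_ st) H.
  by rewrite /q ler_pdivrMl// mulrCA ler_pdivlMl//; lra.
have qcvg : cvg (q h @[h --> 0^'+]).
  apply/cvg_ex; eexists; apply: (@nondecreasing_at_right_cvgr _ q 0 (BInfty _ false)).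
  - by [].
  - exact: qnd.
  - by exists a => _ [t t0 <-]; apply: aq; move: t0; rewrite /= in_itv/= andbT.
apply/andP; split.
  by apply: (limr_ge qcvg); near=> h; apply: aq; near: h; exact: nbhs_right_gt.
apply: (limr_le qcvg); near=> h.
have h0 : 0 < h by near: h; exact: nbhs_right_gt.
have he : h <= e by near: h; exact: nbhs_right_le.
apply: (@le_trans _ _ (q e)); first by apply: qnd; rewrite ?in_itv/= ?h0 ?e0.
by rewrite /q ler_pdivrMl// mulrC.
Unshelve. all: by end_near. Qed.

End convex_on_line.

(** * Minorants of a function uniformly close to an integrated CDF *)

Section gcm_near_integrated_cdf.
Context (R : realType) (F : cumulativeBounded (0 : R) (1 : R)).
Context (iF : finite_first_moment F).
Let M := integrated_cdf F.

Lemma integrated_cdf_slope (y z : R) : y <= z ->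
  F y * (z - y) <= M z - M y <= F z * (z - y).
Proof.
have ndF := cumulative_is_nondecreasing F.
move=> yz; apply: integrated_cdfB => // t /andP[yt tz].
by rewrite !ndF// ltW.
Qed.

Lemma integrated_cdf_convex : convex_on_line M.
Proof.
(* [F y] is a subgradient of [M] at [y]. *)
apply: convex_on_line_support => y; exists (F y) => z.
by have [/integrated_cdf_slope/andP[]|/ltW/integrated_cdf_slope/andP[]] := leP y z; lra.
Qed.

Context (f : R -> R) (s : R) (fM : forall y, `|f y - M y| <= s).

Lemma is_gcm_near : is_gcm f (gcm f).
Proof.
apply: (@gcmP _ _ (fun y => M y - s)) => [|y].
  apply/convex_on_lineP => t x y t01.
  have /convex_on_lineP/(_ t x y t01) := integrated_cdf_convex; lra.
by have := fM y; rewrite ler_distl => /andP[].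
Qed.

Lemma gcm_near y : `|gcm f y - M y| <= s.
Proof.
have [_ gf maxg] := is_gcm_near.
have Mg : M y - s <= gcm f y.
  apply: (maxg (fun y => M y - s)) => [|z].
    apply/convex_on_lineP => t x z t01.
    have /convex_on_lineP/(_ t x z t01) := integrated_cdf_convex; lra.
  by have := fM z; rewrite ler_distl => /andP[].
by have := fM y; have := gf y; rewrite !ler_distl Mg => fg /andP[_ /(le_trans fg)].
Qed.

Lemma right_derivative_gcm_near (y e : R) : 0 < e ->
  F (y - e) - 2 * s / e <= right_derivative (gcm f) y <= F (y + e) + 2 * s / e.
Proof.
move=> e0.
have [cg _ _] := is_gcm_near.
have := gcm_near y; rewrite ler_distl => /andP[gy1 gy2].
have := gcm_near (y - e); rewrite ler_distl => /andP[gl1 gl2].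
have := gcm_near (y + e); rewrite ler_distl => /andP[gr1 gr2].
have ne0 : e != 0 by rewrite gt_eqF.
apply: (right_derivative_bounds cg e0) => [z yz|].
- have ye : y - e <= y by rewrite gerBl ltW.
  have /andP[FM _] := integrated_cdf_slope ye.
  have yez : y - e <= y <= z by rewrite ye ltW.
  have chord := convex_on_line_chord cg yez.
  have zy0 : 0 < z - y by rewrite subr_gt0.
  rewrite -(ler_pM2l e0).
  have -> : e * ((F (y - e) - 2 * s / e) * (z - y)) =
      (F (y - e) * e - 2 * s) * (z - y) by field.
  (* Over [[y - e, y]], [M] grows by at least [F (y - e) * e], and replacing [M] by [gcm f] costs
     [s] at each end; [chord] then passes to [[y, z]]. *)
  apply: (@le_trans _ _ ((gcm f y - gcm f (y - e)) * (z - y))); last by lra.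
  by apply: ler_wpM2r; [exact: ltW|lra].
- have ye : y <= y + e by rewrite lerDl ltW.
  have /andP[_ MF] := integrated_cdf_slope ye.
  have -> : (F (y + e) + 2 * s / e) * e = F (y + e) * e + 2 * s by field.
  lra.
Qed.

Lemma right_derivative_gcm_affine (p q y : R) :
  (forall t, p <= t < q -> F t = F p) ->
  (forall t, p <= t <= q -> f t = f p + (f q - f p) / (q - p) * (t - p)) ->
  p <= y < q ->
  `|right_derivative (gcm f) y - F y| <= 2 * s / (q - p).
Proof.
move=> Fp fa pyq; have /andP[py yq] := pyq; have pq := le_lt_trans py yq.
have [cg _ _] := is_gcm_near.
have [lg lE] := gcm_affine is_gcm_near pq fa.
have qp0 : 0 < q - p by rewrite subr_gt0.
have qy0 : 0 < q - y by rewrite subr_gt0.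
have Fpq t : p < t < q -> F p <= F t <= F p.
  by move=> /andP[pt tq]; rewrite Fp ?lexx// ltW.
have := @integrated_cdfB _ F (F p) (F p) p q iF (ltW pq) Fpq.
rewrite -/M => /andP[MF1 MF2].
have := gcm_near p; rewrite ler_distl => /andP[gp1 gp2].
have := gcm_near q; rewrite ler_distl => /andP[gq1 gq2].
pose b := (gcm f q - gcm f p) / (q - p).
have gyE : gcm f y = gcm f p + b * (y - p) by apply: lE; rewrite py ltW.
(* The chord line over [[p, q]] minorises [gcm f] everywhere and meets it at [y] and [q], so the
   slope [b] serves as both bounds, with step [q - y]. *)
have /andP[b1 b2] : b <= right_derivative (gcm f) y <= b.
  apply: (right_derivative_bounds cg qy0) => [z _|].
  - by have := lg z; rewrite gyE -/b; lra.
  - by rewrite subrKC lE ?(ltW pq) ?lexx// gyE -/b; lra.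
have -> : right_derivative (gcm f) y = b by apply/le_anti; rewrite b1 b2.
rewrite (Fp y)// ler_distl.
have bE : b * (q - p) = gcm f q - gcm f p by rewrite /b divfK// gt_eqF.
have sE : 2 * s / (q - p) * (q - p) = 2 * s by rewrite divfK// gt_eqF.
by apply/andP; split; rewrite -(ler_pM2r qp0); lra.
Qed.

End gcm_near_integrated_cdf.

(** * Integer-supported CDFs and the unit grid *)

Lemma supported_in_Z_cst (R : realType) (F : cumulativeBounded (0 : R) (1 : R))
    (k : int) (y : R) :
  supported_in_Z F -> k%:~R <= y < (k + 1)%:~R -> F y = F k%:~R.
Proof.
move=> FZ /andP[ky yk].
(* The increment of [F] is the mass of a half-open interval that contains no integer, as
   [y < k + 1]. *)
have E : lebesgue_stieltjes_measure F `]k%:~R, y] = (F y - F k%:~R)%:E.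
  rewrite /lebesgue_stieltjes_measure /measure_extension measurable_mu_extE/=.
    by rewrite wlength_itv_bnd.
  exact: is_ocitv.
apply/eqP; rewrite -subr_eq0 -eqe -E -measure_le0 -FZ.
apply: le_mu_ext => t /=; rewrite in_itv/= => /andP[kt ty] [j _ jt].
move: kt (le_lt_trans ty yk); rewrite -jt !ltr_int ltzD1 => kj jk.
by rewrite leNgt kj in jk.
Qed.

Section unit_grid.
Context (R : realType) (n : nat) (Y : 'I_n -> R).
Context (Yint : forall i, Y i \is a Num.int).

Lemma distinct_values_int (i : nat) : (distinct_values Y)`_i \is a Num.int.
Proof.
(* Past the end, [nth] returns 0, again an integer. *)
have [iY|iY] := ltnP i (size (distinct_values Y)); last by rewrite nth_default.
have := mem_nth 0 iY; rewrite mem_sort mem_undup => /codomP[j ->].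
exact: Yint.
Qed.

(** Left of the grid [f] vanishes and right of it [f] has slope 1; in between, integer cells are
    interpolation cells, since the grid starts at an integer and has unit steps. *)
Lemma grid_extension_affine (f : R -> R) (k : int) (y : R) :
  grid_extension (unit_grid Y) f -> k%:~R <= y <= (k + 1)%:~R ->
  f y = f k%:~R + (f (k + 1)%:~R - f k%:~R) / ((k + 1)%:~R - k%:~R) * (y - k%:~R).
Proof.
rewrite /grid_extension /unit_grid size_map size_iota succnK.
have /intrP[a aE] := distinct_values_int 0; rewrite aE.
move: (Num.truncn _) => N [fin f0 f1] /andP[ky yk].
have tE (j : nat) : (j <= N)%N ->
    [seq a%:~R + k%:R | k <- iota 0 N.+1]`_j = (a + j%:Z)%:~R :> R.
  by move=> jN; rewrite (nth_map 0%N) ?size_iota// nth_iota// add0n intrD.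
have kk : k%:~R <= (k + 1)%:~R :> R by rewrite ler_int lerDl.
have E1 : (k + 1)%:~R - k%:~R = 1 :> R by rewrite intrD addrAC subrr add0r.
rewrite E1 divr1.
have [ka|ak] := leP (k + 1) a.
  have ka' : (k + 1)%:~R <= a%:~R :> R by rewrite ler_int.
  have f0' z : z <= (k + 1)%:~R -> f z = 0.
    by move=> zk; apply: f0; rewrite tE// addr0 (le_trans zk).
  by rewrite !f0'//; lra.
have [Nk|kN] := leP (a + N%:Z) k.
  have f1' z : k%:~R <= z -> f z = f (a + N%:Z)%:~R + (z - (a + N%:Z)%:~R).
    by move=> kz; rewrite {1}f1 tE// (le_trans _ kz)// ler_int.
  by rewrite (f1' y)// (f1' k%:~R)// (f1' (k + 1)%:~R)//; move: E1; lra.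
(* Here [a <= k < a + N], so [k] is the grid point of index [k - a]. *)
have /andP[jN /eqP kj] : (`|k - a| < N)%N && (k == a + `|k - a|%:Z) by lia.
move: fin => /(_ `|k - a|%N y jN); rewrite (tE _ jN) (tE _ (ltnW jN)).
have -> : a + `|k - a|.+1%:Z = k + 1 by lia.
rewrite -kj E1 divr1 ky yk => /(_ isT) ->; ring.
Qed.

End unit_grid.

(** * Suprema of distances and outer probabilities *)

Section sup_dist.
Context (R : realType) (A B : set R) (f g : R -> R -> R).

Lemma sup_dist_le (s : R) :
  (forall x y, B x -> A y -> `|f x y - g x y| <= s) ->
  (sup_dist A B f g <= s%:E)%E.
Proof.
move=> fg; apply: ge_ereal_sup => _ [y Ay [x Bx <-]].
by rewrite lee_fin fg.
Qed.

(** The supremum itself serves as [s], unless it is [-oo]: the index set is then empty and any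
    number below [r] will do. *)
Lemma sup_dist_lt (r : R) : (sup_dist A B f g < r%:E)%E ->
  exists2 s, s < r & forall x y, B x -> A y -> `|f x y - g x y| <= s.
Proof.
have ub x y : B x -> A y -> (`|f x y - g x y|%:E <= sup_dist A B f g)%E.
  by move=> Bx Ay; apply: ereal_sup_ubound; exists y => //; exists x.
case: (sup_dist A B f g) ub => [s ub|//|ub _].
- by rewrite lte_fin => sr; exists s.
- exists (r - 1) => [|x y Bx Ay]; first by rewrite ltrBlDr ltrDl.
  by have := ub _ _ Bx Ay; rewrite leeNy_eq.
Qed.

End sup_dist.

(** Monotonicity of the outer measure and squeezing. The empty sample [n = 0] is left out, which
    does not affect the limit. *)
Lemma outer_prob_cvg0_sub (R : realType) (d : measure_display)
    (T : measurableType d) (P : probability T R) (A B : nat -> set T) :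
  (forall n, (0 < n)%N -> B n `<=` A n) ->
  outer_prob P (A n) @[n --> \oo] --> 0%E ->
  outer_prob P (B n) @[n --> \oo] --> 0%E.
Proof.
move=> BA A0; apply: (squeeze_cvge _ (cvg_cst 0%E) A0).
near=> n; rewrite mu_ext_ge0//=; apply: le_mu_ext; apply: BA.
by near: n; exact: nbhs_infty_gt.
Unshelve. all: by end_near. Qed.

(** * Convergence rates from the deterministic bounds *)

Theorem proposition3p1 (R : realType) (d : measure_display)
  (T : measurableType d) (P : probability T R)
  (* index set of the family of CDFs; [F x] is irrelevant for [x] outside it *)
  (Theta : set R) (F : R -> cumulativeBounded (0 : R) (1 : R))
  (hmoment : forall x, Theta x -> finite_first_moment (F x))
  (horder : forall x x' : R, Theta x -> Theta x' -> x <= x' ->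
     forall y : R, integrated_cdf (F x') y <= integrated_cdf (F x) y)
  (X Y : forall n : nat, 'I_n -> {RV P >-> R})
  (hXTheta : forall (n : nat) (i : 'I_n) (w : T), Theta (X n i w))
  (hXindep : forall n : nat, mutually_independent (X n))
  (hYindep : forall n : nat, cond_independent (g_sigma_preimage (X n)) (Y n))
  (hYcdf : forall (n : nat) (i : 'I_n),
     cond_cdf (g_sigma_preimage (X n)) (Y n i) (fun w => F (X n i w)))
  (c : nat -> R) (hc : forall n, 0 <= c n)
  (Iset : set R) (hI : Iset `<=` Theta)
  (In : nat -> set R) (hIn : forall n, In n `<=` Iset) :
  let M := fun x : R => integrated_cdf (F x) in
  let condA := fun Mt : nat -> T -> R -> R -> R =>
    (fun n => outer_prob P
       [set w | ((c n)%:E <= sup_dist setT (In n) (Mt n w) M)%E])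
      @ \oo --> 0%E in
  (forall Mt : nat -> T -> R -> R -> R,
     (forall (n : nat) (w : T), (0 < n)%N ->
        is_Mtilde (fun i => X n i w) (fun i => Y n i w) (Mt n w)) ->
     condA Mt ->
     forall (J : set R) (C beta : R), 0 <= C -> 0 < beta ->
     (forall x y z : R, Iset x -> J y -> J z ->
        `|F x y - F x z| <= C * `|y - z| `^ beta) ->
     let Jn := fun n : nat =>
       [set y | [/\ J y, J (y - c n `^ (1 / (1 + beta))) &
                    J (y + c n `^ (1 / (1 + beta)))]] in
     (fun n => outer_prob P
        [set w | (((2 + C) * c n `^ (beta / (1 + beta)))%:E
                  <= sup_dist (Jn n) (In n) (Fhat (Mt n w)) F)%E])
       @ \oo --> 0%E)
  /\
  (forall Mt : nat -> T -> R -> R -> R,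
     (forall x : R, Iset x -> supported_in_Z (F x)) ->
     (forall (n : nat) (i : 'I_n) (w : T), Y n i w \is a Num.int) ->
     (forall (n : nat) (w : T), (0 < n)%N ->
        is_Mtilde_grid (fun i => X n i w) (fun i => Y n i w)
          (unit_grid (fun i => Y n i w)) (Mt n w)) ->
     condA Mt ->
     (fun n => outer_prob P
        [set w | ((2 * c n)%:E
                  <= sup_dist setT (In n) (Fhat (Mt n w)) F)%E])
       @ \oo --> 0%E).
Proof.
move=> M condA.
have FM n x : In n x -> finite_first_moment (F x) by move=> /hIn/hI; exact: hmoment.
(* An empty [In n] is set apart: the supremum is then [-oo], below the threshold even if [c n] is
   0. *)
have vacuous n (A : set R) (f g : R -> R -> R) (r : R) :
    ~ (exists x, In n x) -> 0 <= r -> (sup_dist A (In n) f g < r%:E)%E.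
  move=> noI r0; apply: (@le_lt_trans _ _ (-1)%:E); last by rewrite lte_fin; lra.
  by apply: sup_dist_le => x y Ix _; case: noI; exists x.
split.
- move=> Mt _ hA J C beta C0 beta0 Fholder Jn.
  have b1 : 0 < 1 + beta by lra.
  (* By contraposition, it remains to bound the error strictly at each outcome outside the event of
     (A). *)
  apply: outer_prob_cvg0_sub hA => n n0 w /=; apply: contraTT; rewrite -!ltNge.
  set gam := c n `^ (beta / (1 + beta)).
  have gam0 : 0 <= gam by exact: powR_ge0.
  have [[x0 Ix0]|noI _] := pselect (exists x, In n x); last first.
    by apply: vacuous => //; rewrite mulr_ge0// addr_ge0.
  move=> /sup_dist_lt[s sc hs].
  (* A point of [In n] gives [0 <= s < c n], which makes the bandwidth [del] positive. *)
  have c0 : 0 < c n.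
    by apply: le_lt_trans sc; exact: le_trans (hs x0 0 Ix0 I).
  (* This bandwidth balances the two errors: [del * gam = c n] turns [2 * s / del] into less than
     [2 * gam], and the Hölder term [C * del ^ beta] equals [C * gam]. *)
  set del := c n `^ (1 / (1 + beta)).
  have del0 : 0 < del by exact: powR_gt0.
  have delgam : del * gam = c n.
    rewrite -powRD; last by apply/implyP => _; rewrite gt_eqF.
    by rewrite -mulrDl divff ?gt_eqF// powRr1.
  have delbeta : del `^ beta = gam by rewrite -powRrM mulrAC mul1r.
  (* A supremum of strict bounds need not be strict, so the bound is stated with [s] in place of
     [c n]. *)
  apply: (@le_lt_trans _ _ (C * gam + 2 * s / del)%:E); last first.
    have sdel : s / del < gam by rewrite ltr_pdivrMr// mulrC delgam.
    by rewrite lte_fin -mulrA; lra.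
  apply: sup_dist_le => x y Ix [Jy Jyl Jyr].
  have := right_derivative_gcm_near (FM _ _ Ix) (fun y => hs x y Ix I) y del0.
  rewrite /Fhat => /andP[rd1 rd2].
  have norm_del : `|del| = del by rewrite gtr0_norm.
  have Er : y + del - y = del by ring.
  have El : y - del - y = - del by ring.
  have := Fholder x _ _ (hIn _ _ Ix) Jyl Jy; have := Fholder x _ _ (hIn _ _ Ix) Jyr Jy.
  rewrite -/del Er El normrN norm_del delbeta.
  rewrite !ler_norml; lra.
- move=> Mt FZ Yint Mgrid hA.
  apply: outer_prob_cvg0_sub hA => n n0 w /=; apply: contraTT; rewrite -!ltNge.
  have [[x0 Ix0]|noI _] := pselect (exists x, In n x); last first.
    by apply: vacuous => //; rewrite mulr_ge0.
  move=> /sup_dist_lt[s sc hs].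
  apply: (@le_lt_trans _ _ (2 * s)%:E); last by rewrite lte_fin ltr_pM2l.
  apply: sup_dist_le => x y Ix _; rewrite /Fhat.
  (* The integer cell containing [y]: [F x] is constant on [[k, k + 1[] and [Mt n w x] is affine on
     [[k, k + 1]]. *)
  set k := Num.floor y.
  have k1 : (k + 1)%:~R - k%:~R = 1 :> R by rewrite intrD addrAC subrr add0r.
  have -> : 2 * s = 2 * s / ((k + 1)%:~R - k%:~R) by rewrite k1 divr1.
  apply: (right_derivative_gcm_affine (FM _ _ Ix) (fun z => hs x z Ix I)).
  + by move=> t; exact/supported_in_Z_cst/FZ/(hIn _ _ Ix).
  + by move=> t; exact: (grid_extension_affine (Yint n ^~ w) ((Mgrid n w n0).2 x)).
  + exact: floor_itv.
Qed.
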